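(* Let $0<s\leq k\leq n$ be positive integers. Let $L=\{\ell_1,\ldots,\ell_s\}$ be a set of $s$ positive integers such that $0<\ell_1<\ldots<\ell_s$. Suppose that $n\geq \binom{k^2}{\ell_1+1}s+\ell_1$. Let $\mathcal{G}=\{G_1,\ldots,G_m\}$ be an $L$-intersecting, $k$-uniform family of $m$ subsets of $[n]$. Then $$ m\leq \binom{n-\ell_1}{s}. $$
   Context: $[n]=\{1,2,\ldots,n\}$. A family $\mathcal{G}$ is a set of (distinct) subsets of $[n]$, so $m=|\mathcal{G}|$. A family $\mathcal{G}$ is $k$-uniform if $|G|=k$ for each $G\in\mathcal{G}$. For a set $L$ of nonnegative integers, a family $\mathcal{G}$ is $L$-intersecting if $|E\cap F|\in L$ for every pair $E,F$ of distinct members of $\mathcal{G}$.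
   Formalization: The formal theorem adds the hypothesis n ≥ ℓ_1 + s, which the bound on n implies when ℓ_1 < k^2; without it the claim fails, e.g. for n = k = s = 1, L = {1}, G = {{1}}, where m = 1 but the bound is 0. Otherwise only empty families are lost. *)

(* Defs.v *)
From mathcomp Require Import all_boot.

Set Implicit Arguments.
Unset Strict Implicit.
Unset Printing Implicit Defensive.

(* The ground set [n] = {1, ..., n} is represented by 'I_n, and a family of
   (distinct) subsets of [n] by an element of {set {set 'I_n}}. *)

Definition uniform (n k : nat) (G : {set {set 'I_n}}) : Prop :=
  forall E : {set 'I_n}, E \in G -> #|E| = k.

Definition L_intersecting (n : nat) (L : seq nat) (G : {set {set 'I_n}}) : Prop :=
  forall E F : {set 'I_n}, E \in G -> F \in G -> E != F -> #|E :&: F| \in L.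

(* Main.v *)
Require Import Defs.
From mathcomp Require Import all_boot all_order all_algebra.
From mathcomp Require Import zify ring.
Import GRing.Theory Num.Theory.

(** Write l for the least element of L and n for the size of the ground set.
    Everything rests on the Ray-Chaudhuri-Wilson bound 'C(n, s) for uniform
    families with s intersection sizes ([ray_chaudhuri_wilson]), applied to
    families all of whose members contain a fixed set A: deleting A leaves a
    uniform family on n - #|A| points whose intersection sizes are those of L
    lowered by #|A| ([star_bound]).

    If the members of G have l points in common, deleting l of them gives the
    bound at once.  Otherwise at most k - l + 2 members of G already have fewer
    than l common points, and their union M has at most k ^ 2 points.  Every
    member B of G meets M in more than l points: if it did not, B would meet
    each of the chosen members in exactly B :&: M, a set of l points, which
    would then lie in all of them ([small_kernel]).  So G is covered by the
    subfamilies of members containing A, for A an l.+1-subset of M.  In such a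
    subfamily the size l is no longer an intersection size, hence it has at most
    'C(n - l.+1, s.-1) members, and
      s * 'C(k ^ 2, l.+1) * 'C(n - l.+1, s.-1)
        <= (n - l) * 'C(n - l.+1, s.-1) = s * 'C(n - l, s).

    The Ray-Chaudhuri-Wilson bound is itself a rank computation.  The matrix
    indexed by the family, with entries \prod_(l <- L) (#|A :&: B| - l), is
    diagonal with nonzero diagonal.  On sets B of size k it is a polynomial of
    degree s in the indicators of the points of B, and such a polynomial is a
    linear combination of the indicators of I \subset B over s-subsets I only
    ([prod_slice_span]).  The matrix thus factors through the s-subsets, and
    the family is no larger than their number. *)

Set Implicit Arguments.
Unset Strict Implicit.
Unset Printing Implicit Defensive.

(** * The Ray-Chaudhuri-Wilson bound *)

(** Raising the degree by one on the slice #|B| = k.  For J \subset B, the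
    number of points of B outside J is k - #|J|, and #|A :&: B| - #|A :&: J| of
    them lie in A.  The first count lets the constant #|A :&: J| - l be spread
    evenly over the sets a |: J, which is why a product of linear factors needs
    no indicators of lower degree. *)
Lemma slice_mulr (T : finType) (A B J : {set T}) (k l : nat) :
  #|B| = k -> #|J| < k ->
  ((J \subset B)%:R * (#|A :&: B|%:R - l%:R) =
   \sum_(a | a \notin J)
      ((a \in A)%:R + (#|A :&: J|%:R - l%:R) / (k - #|J|)%:R)
      * (a |: J \subset B)%:R :> rat)%R.
Proof.
move=> cardB ltJk; have [sJB|nsJB] := boolP (J \subset B); last first.
  rewrite mul0r big1 // => a _; rewrite subUset (negPf nsJB) andbF.
  by rewrite mulr0.
set w := (_ / _)%R.
have E a : (a |: J \subset B) = (a \in B) by rewrite subUset sub1set sJB andbT.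
under eq_bigr do rewrite E.
rewrite (bigID (mem B)) /= [X in (_ = _ + X)%R]big1 ?addr0; last first.
  by move=> a /andP[_ /negPf->]; rewrite mulr0.
rewrite (eq_bigr (fun a => (a \in A)%:R + w)%R); last first.
  by move=> a /andP[_ ->]; rewrite mulr1.
have P a : (a \notin J) && (a \in B) = (a \in B :\: J) by rewrite inE.
under eq_bigl do rewrite P.
rewrite big_split /= sumr_const cardsD (setIidPr sJB) cardB.
rewrite -natr_sum -big_mkcondr /= sum1_card.
have -> : #|[pred a | (a \in B :\: J) && (a \in A)]| = #|A :&: B| - #|A :&: J|.
  have -> : #|A :&: J| = #|A :&: B :&: J|.
    apply: eq_card => x; rewrite !inE -andbA.
    by case: (x \in J) (subsetP sJB x) => [->|] //; rewrite ?andbF.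
  rewrite -cardsD; apply: eq_card => x; rewrite !inE.
  by rewrite -andbA [(x \in A) && _]andbC.
rewrite natrB; last by rewrite subset_leq_card // setIS.
rewrite -[(w *+ _)%R]mulr_natr /w divfK ?mul1r; last first.
  by rewrite pnatr_eq0 -lt0n subn_gt0.
by ring.
Qed.

(** Induction on L: by [slice_mulr], each further factor turns indicators of
    J \subset B into indicators of the sets a |: J, one point larger. *)
Lemma prod_slice_span (T : finType) (A : {set T}) (k : nat) (L : seq nat) :
  size L <= k ->
  exists c : {set T} -> rat, forall B : {set T}, #|B| = k ->
  (\prod_(l <- L) (#|A :&: B|%:R - l%:R) =
   \sum_(I : {set T} | #|I| == size L) c I * (I \subset B)%:R)%R.
Proof.
elim: L => [|l L IHL] /= leLk.
  exists (fun=> 1%R) => B _; rewrite big_nil (big_pred1 set0) => [|I /=].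
    by rewrite sub0set mulr1.
  by rewrite cards_eq0.
have [c cP] := IHL (ltnW leLk).
pose w (J : {set T}) a : rat :=
  ((a \in A)%:R + (#|A :&: J|%:R - l%:R) / (k - #|J|)%:R)%R.
exists (fun I : {set T} => \sum_(a in I) c (I :\ a) * w (I :\ a) a)%R => B cardB.
rewrite big_cons (cP B cardB) mulr_sumr.
transitivity (\sum_(J : {set T} | #|J| == size L) \sum_(a | a \notin J)
    c J * w J a * (a |: J \subset B)%:R)%R.
  apply: eq_bigr => J /eqP cardJ; rewrite mulrC -mulrA.
  rewrite (slice_mulr _ _ cardB) ?cardJ // mulr_sumr.
  by apply: eq_bigr => a _; rewrite /w cardJ mulrA.
under [RHS]eq_bigr do rewrite mulr_suml.
(* Index by the added point a; then J and I correspond by I = a |: J. *)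
rewrite (exchange_big_dep predT) //= [RHS](exchange_big_dep predT) //=.
apply: eq_bigr => a _.
rewrite (reindex_onto (fun I => I :\ a) (fun J => a |: J)) /=; last first.
  by move=> J /andP[_ aJ]; rewrite setU1K.
apply: eq_big => [I|I].
  rewrite !inE eqxx andbT.
  have [aI|aI] := boolP (a \in I); last first.
    rewrite andbF; apply/negP => /andP[_ /eqP E]; move: aI.
    by rewrite -E !inE eqxx.
  by rewrite setD1K // eqxx !andbT (cardsD1 a I) aI.
by move=> /andP[_ /eqP->].
Qed.

(** The condition k \notin L keeps the diagonal of the matrix of products
    nonzero, and size L <= k allows the passage to sets of size exactly
    size L. *)
Lemma ray_chaudhuri_wilson (T : finType) (X : {set T}) (k : nat) (L : seq nat)
    (F : {set {set T}}) :
  size L <= k -> k \notin L ->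
  (forall B, B \in F -> B \subset X /\ #|B| = k) ->
  (forall A B, A \in F -> B \in F -> A != B -> #|A :&: B| \in L) ->
  #|F| <= 'C(#|X|, size L).
Proof.
move=> leLk kL FP FL; rewrite -cards_draws.
set D := [set I | _].
have [c cP] := fin_all_exists (fun A : {set T} => prod_slice_span A leLk).
pose f (A B : {set T}) : rat := (\prod_(l <- L) (#|A :&: B|%:R - l%:R))%R.
pose N : 'M[rat]_(#|F|, #|D|) := (\matrix_(i, j) c (enum_val i) (enum_val j))%R.
pose W : 'M[rat]_(#|D|, #|F|) :=
  (\matrix_(i, j)
    ((enum_val i : {set T}) \subset (enum_val j : {set T}))%:R)%R.
pose d : 'rV[rat]_#|F| := (\row_i f (enum_val i) (enum_val i))%R.
have NW : (N *m W = diag_mx d)%R.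
  apply/matrixP => i j; rewrite !mxE.
  (* Only the I inside X matter, since the column set B lies in X. *)
  have [sBX cardB] := FP _ (enum_valP j).
  transitivity (f (enum_val i) (enum_val j)).
    rewrite /f (cP _ _ cardB).
    under eq_bigr do rewrite !mxE.
    rewrite -(big_enum_val (fun I : {set T} =>
      c (enum_val i) I * (I \subset enum_val j)%:R)%R).
    rewrite [RHS](bigID (fun I : {set T} => I \subset X)) /=.
    rewrite [X in (_ = _ + X)%R]big1 ?addr0; last first.
      move=> I /andP[_ /negP sIX]; case: (boolP (I \subset _)) => [sIB|_].
        by case: sIX; apply: subset_trans sBX.
      by rewrite mulr0.
    by apply: eq_bigl => I; rewrite inE andbC.
  have [->|neq_ij] := eqVneq i j; first by rewrite mulr1n.
  rewrite mulr0n /f; apply/eqP; rewrite prodf_seq_eq0; apply/hasP.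
  exists #|(enum_val i : {set T}) :&: enum_val j|; last by rewrite /= subrr.
  by apply: FL; rewrite ?enum_valP // (inj_eq enum_val_inj).
have : \rank (N *m W)%R = #|F|.
  apply: mxrank_unit; rewrite NW unitmxE det_diag unitfE prodf_seq_neq0.
  apply/allP => i _; rewrite mxE /f setIid prodf_seq_neq0; apply/allP => l Ll /=.
  have [_ ->] := FP _ (enum_valP i); rewrite subr_eq0 eqr_nat.
  by apply: contra kL => /eqP->.
by move=> <-; apply: leq_trans (mulmx_max_rank _ _) _.
Qed.

(** * Families with a common part *)

Lemma leq_bin_half (N a b : nat) : a <= b -> b.*2 <= N -> 'C(N, a) <= 'C(N, b).
Proof.
move=> /subnK<-; elim: (b - a) => //= d IHd le_dN.
apply: leq_trans (IHd _) _; first by lia.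
rewrite -(@leq_pmul2l (d + a).+1) // addSn mul_bin_left leq_mul2r.
by apply/orP; right; lia.
Qed.

(** Sizes l of L with l < #|A| or k <= l never occur, so fewer than s sizes may
    remain after deleting A; s.*2 <= #|T| - #|A| places s in the range where
    binomial coefficients increase, so that the bound with s still holds. *)
Lemma star_bound (T : finType) (A : {set T}) (k s : nat) (L : seq nat)
    (F : {set {set T}}) :
  uniq L -> count (leq #|A|) L <= s -> s.*2 <= #|T| - #|A| ->
  (forall B, B \in F -> A \subset B /\ #|B| = k) ->
  (forall B C, B \in F -> C \in F -> B != C -> #|B :&: C| \in L) ->
  #|F| <= 'C(#|T| - #|A|, s).
Proof.
move=> uL cntL les FP FL; have [->|[B0 /FP[sAB0 cardB0]]] := set_0Vmem F.
  by rewrite cards0.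
have leAk : #|A| <= k by rewrite -cardB0 subset_leq_card.
have subAK (B : {set T}) : A \subset B -> A :|: (B :\: A) = B.
  by move=> sAB; rewrite -[RHS](setID B A) (setIidPr sAB).
pose L1 := [seq l <- L | #|A| <= l < k]; pose L' := [seq l - #|A| | l <- L1].
have L1P l : l \in L1 -> #|A| <= l < k by rewrite mem_filter => /andP[].
have uL' : uniq L'.
  rewrite map_inj_in_uniq ?filter_uniq // => x y /L1P ? /L1P ?; lia.
have sizeL' : size L' <= k - #|A|.
  rewrite -(size_iota 0 (k - #|A|)); apply: uniq_leq_size => // x /mapP[y /L1P ? ->].
  by rewrite mem_iota; lia.
have sizeL's : size L' <= s.
  rewrite size_map size_filter; apply: leq_trans cntL.
  by apply: sub_count => l /= /andP[].
have injF : {in F &, injective (fun B : {set T} => B :\: A)}.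
  by move=> B C /FP[sAB _] /FP[sAC _] /= E; rewrite -(subAK B) // E subAK.
rewrite -(card_in_imset injF) -[in X in 'C(X, _)](cardsC A) addKn.
apply: leq_trans (leq_bin_half sizeL's _); last by have := cardsC A; lia.
apply: (@ray_chaudhuri_wilson _ _ (k - #|A|)) => //.
- by apply/mapP => -[l /L1P ?]; lia.
- move=> _ /imsetP[B /FP[sAB cardB] ->]; split; first by rewrite setDE subsetIr.
  by rewrite cardsD (setIidPr sAB) cardB.
move=> _ _ /imsetP[B BF ->] /imsetP[C CF ->] neq.
have neBC : B != C by apply: contraNneq neq => ->.
have [[sAB cardB] [sAC cardC]] := (FP _ BF, FP _ CF).
have sAI : A \subset B :&: C by rewrite subsetI sAB.
rewrite -setDIl cardsD (setIidPr sAI); apply/mapP; exists #|B :&: C| => //.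
rewrite mem_filter FL // subset_leq_card //= andbT -cardB.
apply: proper_card; rewrite properEneq subsetIl andbT.
apply: contraNneq neBC => /setIidPl sBC.
by rewrite eqEcard sBC cardB cardC leqnn.
Qed.

(** * Families without a large common part *)

Lemma subset_of_card (T : finType) (X : {set T}) (l : nat) :
  l <= #|X| -> exists2 A : {set T}, A \subset X & #|A| = l.
Proof.
rewrite -bin_gt0 -cards_draws card_gt0 => /set0Pn[A].
by rewrite inE => /andP[sAX /eqP cardA]; exists A.
Qed.

(** The set M is the union of members picked one at a time, each new one missing
    a point common to the previous ones.  The intersection thus loses a point
    at each step, and falls below l after at most k - l + 1 steps; the union
    gains at most k - l points, because members meet in at least l points.  The
    total k + (k - l + 1) * (k - l) is at most k ^ 2 as l > 0. *)
Lemma small_kernel (T : finType) (k l : nat) (F : {set {set T}}) :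
  0 < l -> F != set0 ->
  (forall B, B \in F -> #|B| = k) ->
  (forall B C, B \in F -> C \in F -> l <= #|B :&: C|) ->
  #|\bigcap_(B in F) B| < l ->
  exists2 M : {set T}, #|M| <= k ^ 2 & forall B, B \in F -> l < #|B :&: M|.
Proof.
move=> l_gt0 /set0Pn[B0 FB0] Fk Fl ltFl.
have lelk : l <= k by rewrite -(Fk _ FB0) -[B0]setIid Fl.
have greedy t : exists H : {set {set T}}, [/\ B0 \in H, H \subset F,
    #|cover H| <= k + t * (k - l) &
    (#|\bigcap_(B in H) B| < l) || (#|\bigcap_(B in H) B| + t <= k)].
  elim: t => [|t [H [HB0 sHF covH capH]]].
    exists [set B0]; rewrite inE sub1set /cover !big_set1 addn0 Fk //.
    by rewrite eqxx FB0 leqnn orbT; split=> //; lia.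
  have [capHl|leHl] := ltnP #|\bigcap_(B in H) B| l.
    by exists H; split; rewrite // ?capHl //; lia.
  have [E FE nHE] : exists2 E, E \in F & ~~ (\bigcap_(B in H) B \subset E).
    apply/exists_inP; rewrite -negb_forall_in; apply/negP => /forall_inP sHF'.
    have/subset_leq_card: \bigcap_(B in H) B \subset \bigcap_(B in F) B.
      by apply/bigcapsP.
    by lia.
  have nHE' : E \notin H by apply: contra nHE => HE; apply: bigcap_inf.
  have covU : cover (E |: H) = E :|: cover H by rewrite /cover big_setU1.
  have capU : \bigcap_(B in E |: H) B = E :&: \bigcap_(B in H) B.
    by rewrite big_setU1.
  exists (E |: H); rewrite covU capU; split.
  - by rewrite !inE HB0 orbT.
  - by rewrite subUset sub1set FE.
  - have := cardsUI E (cover H); rewrite (Fk E) //.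
    have : l <= #|E :&: cover H|.
      apply: leq_trans (Fl _ _ FE FB0) _.
      by rewrite subset_leq_card // setIS // bigcup_sup.
    by rewrite mulSn; lia.
  - apply/orP; right.
    have : #|E :&: \bigcap_(B in H) B| < #|\bigcap_(B in H) B|.
      apply: proper_card; rewrite properEneq subsetIr andbT.
      by apply: contra nHE => /eqP/setIidPr.
    by lia.
have [H [HB0 sHF covH capH]] := greedy (k - l).+1.
have {}capH : #|\bigcap_(B in H) B| < l by lia.
exists (cover H); first by apply: leq_trans covH _; nia.
move=> B FB; rewrite ltnNge; apply/negP => leBl.
suff /subset_leq_card : B :&: cover H \subset \bigcap_(E in H) E.
  have : l <= #|B :&: cover H|.
    apply: leq_trans (Fl _ _ FB FB0) _.
    by rewrite subset_leq_card // setIS // bigcup_sup.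
  by lia.
apply/bigcapsP => E HE.
have sEH : B :&: E \subset B :&: cover H by rewrite setIS // bigcup_sup.
have /eqP<- : B :&: E == B :&: cover H.
  by rewrite eqEcard sEH (leq_trans leBl) // Fl // (subsetP sHF).
exact: subsetIr.
Qed.

(** * The bound *)

(* L lists l_1 < ... < l_s in increasing order, so nth 0 L 0 is l_1 (s > 0).
   The hypothesis l_1 + s <= n follows from the lower bound on n whenever
   l_1 < k ^ 2; it only excludes the degenerate case in which both binomial
   coefficients vanish, where a one-member family would refute the bound. *)
Theorem theorem1p10 (n k s : nat) (L : s.-tuple nat) (G : {set {set 'I_n}}) :
  0 < s -> s <= k -> k <= n ->
  sorted ltn L ->
  0 < nth 0 L 0 ->
  'C(k ^ 2, (nth 0 L 0).+1) * s + nth 0 L 0 <= n ->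
  nth 0 L 0 + s <= n ->
  uniform k G ->
  L_intersecting L G ->
  #|G| <= 'C(n - nth 0 L 0, s).
Proof.
move=> s_gt0 _ _ sortL; set l := nth 0 L 0 => l_gt0 len lsn Gk GL.
have [p defL] : exists p, tval L = l :: p.
  rewrite /l; case: L {sortL l l_gt0 len lsn GL} => -[/eqP|a p] //=; first lia.
  by exists p.
have sizep : size p = s.-1 by rewrite -(size_tuple L) defL.
have uL : uniq L by apply: sorted_uniq sortL; [exact: ltn_trans | exact: ltnn].
have pl : all (ltn l) p.
  by move: sortL; rewrite defL; apply: order_path_min; exact: ltn_trans.
have leL m : m \in tval L -> l <= m.
  by rewrite defL inE => /predU1P[->|/(allP pl)/ltnW].
(* If k <= l then two distinct members cannot meet in l or more points. *)
have [lekl|ltlk] := leqP k l.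
  apply: (@leq_trans 1); last by rewrite bin_gt0; lia.
  apply/card_le1_eqP => C B GC GB; apply/eqP/negPn/negP => neq.
  have leI : k <= #|B :&: C|.
    by apply: leq_trans lekl (leL _ (GL _ _ GB GC neq)).
  case/negP: neq; rewrite eqEcard (Gk _ GB) (Gk _ GC) leqnn andbT.
  by apply/setIidPl/eqP; rewrite eqEcard subsetIl (Gk _ GB).
(* This makes n - l at least s.*2, as star_bound requires. *)
have C2 : 1 < 'C(k ^ 2, l.+1).
  have : 'C(k ^ 2, 1) <= 'C(k ^ 2, l.+1) by apply: leq_bin_half => //; nia.
  by rewrite bin1; nia.
have [->|Gn0] := eqVneq G set0; first by rewrite cards0.
have Gl B C : B \in G -> C \in G -> l <= #|B :&: C|.
  move=> GB GC; have [->|neq] := eqVneq B C; first by rewrite setIid Gk // ltnW.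
  by apply: leL; apply: GL.
have starG (A : {set 'I_n}) r :
    count (leq #|A|) L <= r -> r.*2 <= n - #|A| ->
    #|[set B in G | A \subset B]| <= 'C(n - #|A|, r).
  move=> cntA ler.
  have := @star_bound _ A k r L [set B in G | A \subset B] uL cntA.
  rewrite card_ord; apply=> // [B|B C].
    by rewrite inE => /andP[/Gk cardB sAB]; split.
  by rewrite !inE => /andP[GB _] /andP[GC _]; apply: GL.
have [ltGl|leGl] := ltnP #|\bigcap_(B in G) B| l; last first.
  have [A sA cardA] := subset_of_card leGl; rewrite -cardA.
  apply: leq_trans (starG A s _ _).
  - apply/subset_leq_card/subsetP => B GB; rewrite inE GB (subset_trans sA) //.
    exact: bigcap_inf.
  - by rewrite (leq_trans (count_size _ _)) // size_tuple.
  - by rewrite cardA; nia.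
have [M leM GM] := small_kernel l_gt0 Gn0 Gk Gl ltGl.
pose D := [set A : {set 'I_n} | A \subset M & #|A| == l.+1].
have sGD : G \subset \bigcup_(A in D) [set B in G | A \subset B].
  apply/subsetP => B GB.
  have [A] := subset_of_card (GM B GB).
  rewrite subsetI => /andP[sAB sAM] cardA.
  by apply/bigcupP; exists A; rewrite inE ?GB ?sAM ?cardA //=.
have leG : #|G| <= 'C(k ^ 2, l.+1) * 'C(n - l.+1, s.-1).
  apply: leq_trans (subset_leq_card sGD) _.
  apply: (@leq_trans (\sum_(A in D) 'C(n - l.+1, s.-1))); last first.
    by rewrite sum_nat_const cards_draws leq_mul2r leq_bin2l ?orbT.
  apply: (@leq_trans (\sum_(A in D) #|[set B in G | A \subset B]|)).
    elim/big_ind2: _ => [|m X m' Y leX leY|//]; first by rewrite cards0.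
    by rewrite (leq_trans (leq_card_setU X Y)) // leq_add.
  apply: leq_sum => A; rewrite inE => /andP[_ /eqP cardA].
  rewrite -cardA; apply: starG; rewrite cardA; last by nia.
  by rewrite defL /= ltnn add0n -sizep count_size.
apply: leq_trans leG _; rewrite -(@leq_pmul2l s) // -[s in X in _ <= X]prednK //.
rewrite -mul_bin_diag mulnA (_ : (n - l).-1 = n - l.+1); last by lia.
by rewrite leq_mul2r; apply/orP; right; lia.
Qed.
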